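(* Let $T=\bigoplus_{n\ge 0}T^n$ be a connected graded $S$-ring and let $P$ be an $S$-subbimodule of $T$. (i) If $P^{\le n}$ is a direct summand of $P^{\le n+1}$ as an $S$-bimodule for every $n\in\mathbb N$, then there is a morphism of filtered $S$-bimodules $\alpha:R_P\to T$ such that $P=\alpha(R_P)$. (ii) Such an $\alpha$ exists provided that $\operatorname{gr}P=\bigoplus_{n} P^{\le n}/P^{\le n-1}$ is projective as an $S$-bimodule. (iii) In particular, if $S$ is a separable algebra over a field, then for every $S$-subbimodule $P$ of $T$ there exists a morphism of filtered $S$-bimodules $\alpha:R_P\to T$ such that $P=\alpha(R_P)$.
   Context: $S$ is an associative unital ring. A positively graded (associative, unital) $S$-ring $T=\bigoplus_{n\ge0}T^n$ is connected if $T^0=S$. Let $p^n:T\to T^n$ be the projection, $T^{\le n}=\bigoplus_{m\le n}T^m$, and $X^{\le n}=X\cap T^{\le n}$ for $X\subseteq T$ (with $X^{\le -1}=0$). For an $S$-subbimodule $P\subseteq T$ put $R_P^n:=p^n(P^{\le n})$ and $R_P:=\bigoplus_{n}R_P^n$, a graded $S$-subbimodule of $T$. For a graded $S$-subbimodule $R$ of $T$, a morphism of filtered $S$-bimodules $\alpha:R\to T$ is an $S$-bimodule map with $\alpha(R^n)\subseteq T^{\le n}$ for all $n$. Its component of degree $-i$ is the $S$-bimodule map $\alpha_i:R\to T$ whose restriction to $R^n$ is $p^{n-i}\alpha$ (zero if $n<i$). By convention, all filtered morphisms $\alpha:R\to T$ are assumed to have $\alpha_0$ equal to the inclusion $R\subseteq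 T$. When $S$ is an algebra over a field $\Bbbk$, $S$-bimodules are left modules over $S\otimes_{\Bbbk}S^{op}$; $S$ is separable if it is projective as an $S$-bimodule. *)

(* Defs.v *)
From HB Require Import structures.
From mathcomp Require Import all_boot all_order all_algebra.
From mathcomp Require Import ring_quotient.
From mathcomp Require Import boolp classical_sets.

Set Implicit Arguments.
Unset Strict Implicit.
Unset Printing Implicit Defensive.

Import GRing.Theory.

Local Open Scope classical_set_scope.
Local Open Scope ring_scope.

Record bimod (S : pzRingType) := Bimod {
  bimod_sort :> zmodType;
  lact : S -> bimod_sort -> bimod_sort;
  ract : bimod_sort -> S -> bimod_sort;
  lactDr : forall a, {morph lact a : x y / x + y};
  lactDl : forall x, {morph lact^~ x : a b / a + b};
  lactA : forall a b x, lact a (lact b x) = lact (a * b) x;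
  lact1 : forall x, lact 1 x = x;
  ractDl : forall a, {morph ract^~ a : x y / x + y};
  ractDr : forall x, {morph ract x : a b / a + b};
  ractA : forall x a b, ract (ract x a) b = ract x (a * b);
  ract1 : forall x, ract x 1 = x;
  lractA : forall a x b, ract (lact a x) b = lact a (ract x b)
}.

Record bimod_hom (S : pzRingType) (M N : bimod S) := BimodHom {
  hom_fun :> M -> N;
  homD : {morph hom_fun : x y / x + y};
  homl : forall a x, hom_fun (lact a x) = lact a (hom_fun x);
  homr : forall x a, hom_fun (ract x a) = ract (hom_fun x) a
}.

Record subbimod (S : pzRingType) (M : bimod S) := Subbimod {
  sub_set :> M -> Prop;
  sub_set0 : sub_set 0;
  sub_setB : forall x y, sub_set x -> sub_set y -> sub_set (x - y);
  sub_setl : forall a x, sub_set x -> sub_set (lact a x);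
  sub_setr : forall x a, sub_set x -> sub_set (ract x a)
}.

Lemma lactB (S : pzRingType) (M : bimod S) a : {morph @lact S M a : x y / x - y}.
Proof. by move=> x y; apply: (addIr (lact a y)); rewrite -lactDr !subrK. Qed.

Lemma ractB (S : pzRingType) (M : bimod S) a :
  {morph (@ract S M)^~ a : x y / x - y}.
Proof.
by move=> x y /=; apply: (addIr (ract y a)); rewrite -ractDl !subrK.
Qed.

Lemma lact0 (S : pzRingType) (M : bimod S) a : @lact S M a 0 = 0.
Proof. by rewrite -[X in lact a X](subrr 0) lactB subrr. Qed.

Lemma ract0 (S : pzRingType) (M : bimod S) a : @ract S M 0 a = 0.
Proof. by rewrite -[X in ract X a](subrr 0) ractB subrr. Qed.

Lemma homB (S : pzRingType) (M N : bimod S) (f : bimod_hom M N) :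
  {morph f : x y / x - y}.
Proof. by move=> x y; apply: (addIr (f y)); rewrite -homD !subrK. Qed.

Lemma hom0 (S : pzRingType) (M N : bimod S) (f : bimod_hom M N) : f 0 = 0.
Proof. by rewrite -[X in f X](subrr 0) homB subrr. Qed.

Lemma sub_setD (S : pzRingType) (M : bimod S) (N : subbimod M) x y :
  N x -> N y -> N (x + y).
Proof.
move=> Nx Ny; rewrite -[y]opprK; apply: sub_setB => //.
by rewrite -sub0r; apply: sub_setB => //; apply: sub_set0.
Qed.

(* An S-ring is a ring T with a ring morphism iota : S -> T. *)

Definition sring_bimod (S T : pzRingType) (iota : {rmorphism S -> T}) : bimod S.
Proof.
apply: (@Bimod S T (fun a t => iota a * t) (fun t a => t * iota a)).
- by move=> a x y; rewrite mulrDr.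
- by move=> x a b; rewrite rmorphD mulrDl.
- by move=> a b x; rewrite rmorphM mulrA.
- by move=> x; rewrite rmorph1 mul1r.
- by move=> a x y; rewrite mulrDl.
- by move=> x a b; rewrite rmorphD mulrDr.
- by move=> x a b; rewrite rmorphM mulrA.
- by move=> x; rewrite rmorph1 mulr1.
- by move=> a x b; rewrite mulrA.
Defined.

Definition regular_bimod (S : pzRingType) : bimod S := sring_bimod (@idfun S).

Definition mem_sub (S : pzRingType) (M : bimod S) (N : subbimod M) : {pred M} :=
  fun x => `[< N x >].

Lemma mem_subP (S : pzRingType) (M : bimod S) (N : subbimod M) x :
  reflect (N x) (x \in mem_sub N).
Proof. exact: asboolP. Qed.

Lemma mem_sub_zmod_closed (S : pzRingType) (M : bimod S) (N : subbimod M) :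
  zmod_closed (mem_sub N).
Proof.
split=> [|x y]; first by apply/mem_subP; apply: sub_set0.
by move=> /mem_subP Nx /mem_subP Ny; apply/mem_subP; apply: sub_setB.
Qed.

HB.instance Definition _ (S : pzRingType) (M : bimod S) (N : subbimod M) :=
  GRing.isZmodClosed.Build M (mem_sub N) (mem_sub_zmod_closed N).

Record sub_sort (S : pzRingType) (M : bimod S) (N : subbimod M) := SubSort {
  sub_val : M;
  sub_valP : sub_val \in mem_sub N
}.

HB.instance Definition _ (S : pzRingType) (M : bimod S) (N : subbimod M) :=
  [isSub for @sub_val S M N].
HB.instance Definition _ (S : pzRingType) (M : bimod S) (N : subbimod M) :=
  [Choice of sub_sort N by <:].
HB.instance Definition _ (S : pzRingType) (M : bimod S) (N : subbimod M) :=
  [SubChoice_isSubZmodule of sub_sort N by <:].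

Lemma sub_lact_subproof (S : pzRingType) (M : bimod S) (N : subbimod M) a
  (x : sub_sort N) : lact a (sub_val x) \in mem_sub N.
Proof. by apply/mem_subP/sub_setl/mem_subP/sub_valP. Qed.

Lemma sub_ract_subproof (S : pzRingType) (M : bimod S) (N : subbimod M) a
  (x : sub_sort N) : ract (sub_val x) a \in mem_sub N.
Proof. by apply/mem_subP/sub_setr/mem_subP/sub_valP. Qed.

Definition sub_bimod (S : pzRingType) (M : bimod S) (N : subbimod M) : bimod S.
Proof.
apply: (@Bimod S (sub_sort N)
  (fun a x => SubSort (sub_lact_subproof a x))
  (fun x a => SubSort (sub_ract_subproof a x))).
- by move=> a x y; apply: val_inj; rewrite /= lactDr.
- by move=> x a b; apply: val_inj; rewrite /= lactDl.
- by move=> a b x; apply: val_inj; rewrite /= lactA.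
- by move=> x; apply: val_inj; rewrite /= lact1.
- by move=> a x y; apply: val_inj; rewrite /= ractDl.
- by move=> x a b; apply: val_inj; rewrite /= ractDr.
- by move=> x a b; apply: val_inj; rewrite /= ractA.
- by move=> x; apply: val_inj; rewrite /= ract1.
- by move=> a x b; apply: val_inj; rewrite /= lractA.
Defined.

Definition incl (S : pzRingType) (M : bimod S) (N : subbimod M) :
  bimod_hom (sub_bimod N) M.
Proof. by apply: (@BimodHom S (sub_bimod N) M (@sub_val S M N)). Defined.

Definition quot_sort (S : pzRingType) (M : bimod S) (N : subbimod M) : zmodType :=
  Quotient.quot (mem_sub N).

Definition quot_pi (S : pzRingType) (M : bimod S) (N : subbimod M) (x : M) :
  quot_sort N := (\pi_(Quotient.quot (mem_sub N)) x)%qT.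

Definition quot_repr (S : pzRingType) (M : bimod S) (N : subbimod M)
  (q : quot_sort N) : M := repr (q : Quotient.quot (mem_sub N)).

Lemma quot_reprK (S : pzRingType) (M : bimod S) (N : subbimod M) :
  cancel (@quot_repr S M N) (@quot_pi S M N).
Proof. by move=> q; apply: reprK. Qed.

Lemma quot_piP (S : pzRingType) (M : bimod S) (N : subbimod M) (x y : M) :
  quot_pi N x = quot_pi N y <-> N (x - y).
Proof.
split=> [/eqP|/mem_subP]; first by rewrite -Quotient.idealrBE => /mem_subP.
by rewrite Quotient.idealrBE => /eqP.
Qed.

Lemma quot_piD (S : pzRingType) (M : bimod S) (N : subbimod M) :
  {morph @quot_pi S M N : x y / x + y}.
Proof. by move=> x y; rewrite /quot_pi !piE. Qed.

Definition quot_lact (S : pzRingType) (M : bimod S) (N : subbimod M) a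
  (q : quot_sort N) : quot_sort N := quot_pi N (lact a (quot_repr q)).

Definition quot_ract (S : pzRingType) (M : bimod S) (N : subbimod M)
  (q : quot_sort N) a : quot_sort N := quot_pi N (ract (quot_repr q) a).

Lemma quot_lactE (S : pzRingType) (M : bimod S) (N : subbimod M) a x :
  quot_lact a (quot_pi N x) = quot_pi N (lact a x).
Proof.
by apply/quot_piP; rewrite -lactB; apply/sub_setl/quot_piP/quot_reprK.
Qed.

Lemma quot_ractE (S : pzRingType) (M : bimod S) (N : subbimod M) x a :
  quot_ract (quot_pi N x) a = quot_pi N (ract x a).
Proof.
by apply/quot_piP; rewrite -ractB; apply/sub_setr/quot_piP/quot_reprK.
Qed.

Definition quot_bimod (S : pzRingType) (M : bimod S) (N : subbimod M) : bimod S.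
Proof.
apply: (@Bimod S (quot_sort N) (@quot_lact S M N) (@quot_ract S M N)).
- move=> a p q; rewrite -[p]quot_reprK -[q]quot_reprK.
  by rewrite -quot_piD !quot_lactE lactDr quot_piD.
- by move=> q a b; rewrite -[q]quot_reprK !quot_lactE lactDl quot_piD.
- by move=> a b q; rewrite -[q]quot_reprK !quot_lactE lactA.
- by move=> q; rewrite -[q]quot_reprK quot_lactE lact1.
- move=> a p q; rewrite -[p]quot_reprK -[q]quot_reprK.
  by rewrite -quot_piD !quot_ractE ractDl quot_piD.
- by move=> q a b; rewrite -[q]quot_reprK !quot_ractE ractDr quot_piD.
- by move=> q a b; rewrite -[q]quot_reprK !quot_ractE ractA.
- by move=> q; rewrite -[q]quot_reprK quot_ractE ract1.
- move=> a q b; rewrite -[q]quot_reprK.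
  by rewrite quot_lactE !quot_ractE quot_lactE lractA.
Defined.

Definition preim_subbimod (S : pzRingType) (M N : bimod S) (f : bimod_hom M N)
  (X : subbimod N) : subbimod M.
Proof.
apply: (@Subbimod S M [set x | X (f x)]) => [|x y|a x|x a] /=.
- by rewrite hom0; apply: sub_set0.
- by rewrite homB; apply: sub_setB.
- by rewrite homl; apply: sub_setl.
- by rewrite homr; apply: sub_setr.
Defined.

Definition im_subbimod (S : pzRingType) (M N : bimod S) (f : bimod_hom M N)
  (X : subbimod M) : subbimod N.
Proof.
apply: (@Subbimod S N (f @` sub_set X)) => [|x y|a x|x a] /=.
- by exists 0; [apply: sub_set0 | rewrite hom0].
- by move=> [u Xu <-] [v Xv <-]; exists (u - v); [apply: sub_setB | rewrite homB].
- by move=> [u Xu <-]; exists (lact a u); [apply: sub_setl | rewrite homl].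
- by move=> [u Xu <-]; exists (ract u a); [apply: sub_setr | rewrite homr].
Defined.

Definition cap_subbimod (S : pzRingType) (M : bimod S) (X Y : subbimod M) :
  subbimod M.
Proof.
apply: (@Subbimod S M (sub_set X `&` sub_set Y)) => [|x y|a x|x a].
- by split; apply: sub_set0.
- by move=> [? ?] [? ?]; split; apply: sub_setB.
- by move=> [? ?]; split; apply: sub_setl.
- by move=> [? ?]; split; apply: sub_setr.
Defined.

(* A / B; used for B contained in A *)
Definition subquot_bimod (S : pzRingType) (M : bimod S) (A B : subbimod M) :
  bimod S := quot_bimod (preim_subbimod (incl A) B).

(* X_0 + ... + X_(n-1), so that n = 0 gives the zero sub-bimodule *)
Definition sum_lt (S : pzRingType) (M : bimod S) (X : nat -> subbimod M)
  (n : nat) : subbimod M.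
Proof.
apply: (@Subbimod S M [set x | exists u : nat -> M,
          (forall m, X m (u m)) /\ x = \sum_(m < n) u m]) => [|x y|a x|x a] /=.
- by exists (fun=> 0); split=> [m|]; [apply: sub_set0 | rewrite big1].
- move=> [u [Xu ->]] [v [Xv ->]]; exists (fun m => u m - v m).
  by split=> [m|]; [apply: sub_setB | rewrite sumrB].
- move=> [u [Xu ->]]; exists (fun m => lact a (u m)).
  split=> [m|]; first exact: sub_setl.
  by rewrite (big_morph _ (lactDr a) (lact0 M a)).
- move=> [u [Xu ->]]; exists (fun m => ract (u m) a).
  split=> [m|]; first exact: sub_setr.
  by rewrite (big_morph _ (ractDl a) (ract0 M a)).
Defined.

Lemma sum_lt_le (S : pzRingType) (M : bimod S) (X : nat -> subbimod M) m n :
  (m <= n)%N -> sub_set (sum_lt X m) `<=` sub_set (sum_lt X n).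
Proof.
move=> le_mn x [u [Xu ->]]; exists (fun i => if (i < m)%N then u i else 0).
split=> [i|]; first by case: ifP => // _; apply: sub_set0.
rewrite (big_ord_widen n u le_mn) big_mkcond /=.
by apply: eq_bigr => i _; case: ifP.
Qed.

Definition sum_subbimod (S : pzRingType) (M : bimod S) (X : nat -> subbimod M) :
  subbimod M.
Proof.
apply: (@Subbimod S M (\bigcup_n sub_set (sum_lt X n))) => [|x y|a x|x a].
- by exists 0%N => //; apply: sub_set0.
- move=> [m _ Xx] [n _ Xy]; exists (maxn m n) => //; apply: sub_setB.
    exact: sum_lt_le (leq_maxl m n) _ Xx.
  exact: sum_lt_le (leq_maxr m n) _ Xy.
- by move=> [n _ Xx]; exists n => //; apply: sub_setl.
- by move=> [n _ Xx]; exists n => //; apply: sub_setr.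
Defined.

Definition prod_sort (S : pzRingType) (M : nat -> bimod S) := forall n, M n.

HB.instance Definition _ (S : pzRingType) (M : nat -> bimod S) :=
  gen_eqMixin (prod_sort M).
HB.instance Definition _ (S : pzRingType) (M : nat -> bimod S) :=
  gen_choiceMixin (prod_sort M).

Lemma prod_addA (S : pzRingType) (M : nat -> bimod S) :
  associative (fun (f g : prod_sort M) => (fun n => f n + g n) : prod_sort M).
Proof. by move=> f g h; apply: functional_extensionality_dep => n; rewrite addrA. Qed.

Lemma prod_addC (S : pzRingType) (M : nat -> bimod S) :
  commutative (fun (f g : prod_sort M) => (fun n => f n + g n) : prod_sort M).
Proof. by move=> f g; apply: functional_extensionality_dep => n; rewrite addrC. Qed.

Lemma prod_add0 (S : pzRingType) (M : nat -> bimod S) :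
  left_id ((fun n => 0) : prod_sort M)
    (fun (f g : prod_sort M) => (fun n => f n + g n) : prod_sort M).
Proof. by move=> f; apply: functional_extensionality_dep => n; rewrite add0r. Qed.

Lemma prod_addN (S : pzRingType) (M : nat -> bimod S) :
  left_inverse ((fun n => 0) : prod_sort M)
    (fun f : prod_sort M => (fun n => - f n) : prod_sort M)
    (fun (f g : prod_sort M) => (fun n => f n + g n) : prod_sort M).
Proof. by move=> f; apply: functional_extensionality_dep => n; rewrite addNr. Qed.

HB.instance Definition _ (S : pzRingType) (M : nat -> bimod S) :=
  GRing.isZmodule.Build (prod_sort M)
    (@prod_addA S M) (@prod_addC S M) (@prod_add0 S M) (@prod_addN S M).

Definition prod_bimod (S : pzRingType) (M : nat -> bimod S) : bimod S.
Proof.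
apply: (@Bimod S (prod_sort M) (fun a f n => lact a (f n))
                               (fun f a n => ract (f n) a)).
- by move=> a f g; apply: functional_extensionality_dep => n; apply: lactDr.
- by move=> f a b; apply: functional_extensionality_dep => n; apply: lactDl.
- by move=> a b f; apply: functional_extensionality_dep => n; apply: lactA.
- by move=> f; apply: functional_extensionality_dep => n; apply: lact1.
- by move=> a f g; apply: functional_extensionality_dep => n; apply: ractDl.
- by move=> f a b; apply: functional_extensionality_dep => n; apply: ractDr.
- by move=> f a b; apply: functional_extensionality_dep => n; apply: ractA.
- by move=> f; apply: functional_extensionality_dep => n; apply: ract1.
- by move=> a f b; apply: functional_extensionality_dep => n; apply: lractA.
Defined.

Definition finsupp_subbimod (S : pzRingType) (M : nat -> bimod S) :
  subbimod (prod_bimod M).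
Proof.
apply: (@Subbimod S (prod_bimod M) [set f : prod_sort M |
          exists N, forall n, (N <= n)%N -> f n = 0]) => [|f g|a f|f a] /=.
- by exists 0%N.
- move=> [m fm] [n gn]; exists (maxn m n) => i; rewrite geq_max => /andP[mi ni].
  by rewrite -[LHS]/(f i - g i) fm // gn // subrr.
- by move=> [m fm]; exists m => i mi; rewrite fm // lact0.
- by move=> [m fm]; exists m => i mi; rewrite fm // ract0.
Defined.

Definition dsum_bimod (S : pzRingType) (M : nat -> bimod S) : bimod S :=
  sub_bimod (finsupp_subbimod M).

Definition direct_summand (S : pzRingType) (M : bimod S) (A B : subbimod M) :=
  sub_set A `<=` sub_set B /\ exists C : subbimod M,
    sub_set A `&` sub_set C = [set 0] /\
    sub_set B = [set a + c | a in sub_set A & c in sub_set C].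

Definition projective_in (S : pzRingType) (C : bimod S -> Prop) (M : bimod S) :=
  C M /\
  forall (N N' : bimod S) (g : bimod_hom N N') (f : bimod_hom M N'),
    C N -> C N' -> (forall y, exists x, g x = y) ->
    exists h : bimod_hom M N, forall x, g (h x) = f x.

Definition projective (S : pzRingType) (M : bimod S) :=
  projective_in (fun _ => True) M.

(* The algebra structure of S over k is given by its structure morphism
   eta : k -> S, whose image has to be central.  The left modules over
   S (x)_k S^op are the S-bimodules on which k acts symmetrically. *)

Definition central (k S : pzRingType) (eta : {rmorphism k -> S}) :=
  forall c a, eta c * a = a * eta c.

Definition symmetric_over (k S : pzRingType) (eta : {rmorphism k -> S})
  (M : bimod S) := forall c (x : M), lact (eta c) x = ract x (eta c).

Definition projective_over (k S : pzRingType) (eta : {rmorphism k -> S})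
  (M : bimod S) := projective_in (symmetric_over eta) M.

Definition separable (k S : pzRingType) (eta : {rmorphism k -> S}) :=
  projective_over eta (regular_bimod S).

Record grading (S T : pzRingType) (iota : {rmorphism S -> T}) := Grading {
  hcomp : nat -> subbimod (sring_bimod iota);
  hproj : nat -> bimod_hom (sring_bimod iota) (sring_bimod iota);
  hproj_comp : forall n t, hcomp n (hproj n t);
  hproj_id : forall n t, hcomp n t -> hproj n t = t;
  hproj_neq : forall m n t, m <> n -> hcomp m t -> hproj n t = 0;
  hproj_sum : forall t, exists N, t = \sum_(n < N) hproj n t;
  hcomp1 : hcomp 0%N 1;
  hcompM : forall m n t u, hcomp m t -> hcomp n u -> hcomp (m + n)%N (t * u)
}.

Definition connected (S T : pzRingType) (iota : {rmorphism S -> T})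
  (G : grading iota) := injective iota /\ sub_set (hcomp G 0%N) = range iota.

(* upto G n is T^{<=n}; capupto G X n is X^{<=n}; caplt G X n is X^{<=n-1},
   which is 0 for n = 0 *)
Definition upto (S T : pzRingType) (iota : {rmorphism S -> T})
  (G : grading iota) (n : nat) := sum_lt (hcomp G) n.+1.

Definition capupto (S T : pzRingType) (iota : {rmorphism S -> T})
  (G : grading iota) (X : subbimod (sring_bimod iota)) (n : nat) :=
  cap_subbimod X (upto G n).

Definition caplt (S T : pzRingType) (iota : {rmorphism S -> T})
  (G : grading iota) (X : subbimod (sring_bimod iota)) (n : nat) :=
  cap_subbimod X (sum_lt (hcomp G) n).

Definition gr (S T : pzRingType) (iota : {rmorphism S -> T})
  (G : grading iota) (P : subbimod (sring_bimod iota)) : bimod S :=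
  dsum_bimod (fun n => subquot_bimod (capupto G P n) (caplt G P n)).

Definition lead_comp (S T : pzRingType) (iota : {rmorphism S -> T})
  (G : grading iota) (P : subbimod (sring_bimod iota)) (n : nat) :=
  im_subbimod (hproj G n) (capupto G P n).

Definition lead (S T : pzRingType) (iota : {rmorphism S -> T})
  (G : grading iota) (P : subbimod (sring_bimod iota)) :=
  sum_subbimod (lead_comp G P).

(* ai is the component of degree -i of alpha; R^n is the intersection of the
   graded sub-bimodule R with T^n *)
Definition component (S T : pzRingType) (iota : {rmorphism S -> T})
  (G : grading iota) (R : subbimod (sring_bimod iota))
  (alpha : bimod_hom (sub_bimod R) (sring_bimod iota)) (i : nat)
  (ai : bimod_hom (sub_bimod R) (sring_bimod iota)) :=
  forall n (r : sub_bimod R), hcomp G n (incl R r) ->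
    ai r = if (i <= n)%N then hproj G (n - i) (alpha r) else 0.

Definition filtered_morphism (S T : pzRingType) (iota : {rmorphism S -> T})
  (G : grading iota) (R : subbimod (sring_bimod iota))
  (alpha : bimod_hom (sub_bimod R) (sring_bimod iota)) :=
  (forall n (r : sub_bimod R), hcomp G n (incl R r) -> upto G n (alpha r)) /\
  component G alpha 0 (incl R).

(* Main.v *)
(* If P^{<=n-1} has a sub-bimodule complement C_n in P^{<=n} for every n, then
   p^n maps C_n isomorphically onto R_P^n, and alpha is the sum of the inverse
   isomorphisms; an induction on the degree shows that its image is all of P.
   Such complements are given in (i), and in (ii) they are the images of
   sections of P^{<=n} -> P^{<=n}/P^{<=n-1}, which lift the projection of gr P
   onto its n-th summand.

   For (iii), every sub-bimodule A of a symmetric bimodule M over a separable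
   algebra S is the image of a bimodule projection. Start from a k-linear
   projection (Zorn). Separability lets one lift central elements along
   surjections of symmetric bimodules; applied to the S-bimodule of additive
   endomorphisms of M, modulo the maps M -> A vanishing on A, this makes the
   projection left linear, and a second such step makes it right linear. No
   tensor product S (x) S is needed. *)

From HB Require Import structures.
From mathcomp Require Import all_boot all_order all_algebra.
From mathcomp Require Import boolp classical_sets functions.
Require Import Defs.

Set Implicit Arguments.
Unset Strict Implicit.
Unset Printing Implicit Defensive.

Import GRing.Theory.

Local Open Scope classical_set_scope.
Local Open Scope ring_scope.

(** * Preliminaries on bimodule homomorphisms *)

(** The hypotheses make [A] a sub-bimodule of the product of [M] and [N] that meets the second
    factor trivially. A map found by arbitrary choices of values thus comes out linear. *)
Lemma hom_of_graph (S : pzRingType) (M N : bimod S) (A : M -> N -> Prop) :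
  (forall x, exists y, A x y) -> (forall y, A 0 y -> y = 0) ->
  (forall x x' y y', A x y -> A x' y' -> A (x - x') (y - y')) ->
  (forall a x y, A x y -> A (lact a x) (lact a y)) ->
  (forall a x y, A x y -> A (ract x a) (ract y a)) ->
  exists2 f : bimod_hom M N, forall x, A x (f x) &
    forall x y, A x y -> f x = y.
Proof.
move=> Atot A0 AB Al Ar; have [f Af] := choice Atot.
have fE x y : A x y -> f x = y.
  move=> /(AB _ _ _ _ (Af x)); rewrite subrr => /A0/eqP.
  by rewrite subr_eq0 => /eqP.
have AD x x' y y' : A x y -> A x' y' -> A (x + x') (y + y').
  move=> Axy Axy'; rewrite -[x']opprK -[y']opprK; apply: (AB _ _ _ _ Axy).
  have A00 : A 0 0 by rewrite -(subrr x) -(subrr y); apply: AB.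
  by rewrite -[- x']sub0r -[- y']sub0r; apply: AB.
unshelve eexists (@BimodHom S M N f _ _ _) => // [x y|a x|x a]; apply: fE.
- exact: AD.
- exact: Al.
- exact: Ar.
Qed.

Lemma sub_setN (S : pzRingType) (M : bimod S) (N : subbimod M) x :
  N x -> N (- x).
Proof.
by move=> Nx; rewrite -sub0r; apply: sub_setB => //; apply: sub_set0.
Qed.

Lemma sub_set_sum (S : pzRingType) (M : bimod S) (N : subbimod M) n
  (u : nat -> M) : (forall m, N (u m)) -> N (\sum_(m < n) u m).
Proof.
move=> Nu; elim/big_ind: _ => //; first exact: sub_set0.
by move=> x y; apply: sub_setD.
Qed.

Lemma hom_sum (S : pzRingType) (M N : bimod S) (f : bimod_hom M N) n
  (u : nat -> M) : f (\sum_(m < n) u m) = \sum_(m < n) f (u m).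
Proof. exact: (big_morph f (homD f) (hom0 f)). Qed.

Lemma lact0l (S : pzRingType) (M : bimod S) (x : M) : lact 0 x = 0.
Proof. by apply: (addIr (lact 0 x)); rewrite -lactDl !add0r. Qed.

Lemma lactBl (S : pzRingType) (M : bimod S) (x : M) :
  {morph (@lact S M)^~ x : a b / a - b}.
Proof. by move=> a b /=; apply: (addIr (lact b x)); rewrite -lactDl !subrK. Qed.

(** * Complements of subspaces over a field *)

Section Field.
Variables (k : fieldType) (V : bimod k) (A : subbimod V).
Hypothesis symV : forall c (x : V), lact c x = ract x c.

Lemma field_complement : exists C : subbimod V,
  (forall x, A x -> C x -> x = 0) /\ (forall x, exists2 a, A a & C (x - a)).
Proof.
pose P (X : set V) := [/\ forall x y, X x -> X y -> X (x - y),
  forall c x, X x -> X (lact c x) & forall x, A x -> X x -> x = 0].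
have [|X [[XB Xl XA] Xmax]] := @Zorn_bigcup _ P.
  move=> F FP Ftot.
  split=> [x y [X FX Xx] [Y FY Yy]|c x [X FX Xx]|x Ax [X FX Xx]].
  - have [XY|YX] := Ftot _ _ FX FY.
      by exists Y => //; have [YB _ _] := FP _ FY; apply: YB => //; apply: XY.
    by exists X => //; have [XB _ _] := FP _ FX; apply: XB => //; apply: YX.
  - by exists X => //; have [_ Xl _] := FP _ FX; apply: Xl.
  - by have [_ _ XA] := FP _ FX; apply: XA.
(* [P] also admits the empty set, the union of the empty chain, so [0] is in [X] only by
   maximality. *)
have X0 : X 0.
  apply: contrapT => nX0; apply: (Xmax [set 0]).
    split=> [|/(_ 0 erefl)] // x Xx; case: nX0.
    by rewrite -(subrr x); apply: XB.
  split=> [x y -> ->|c x ->|//]; first by rewrite subrr.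
  by rewrite lact0.
unshelve eexists (@Subbimod _ V X _ _ _ _) => //.
  by move=> x c Xx; rewrite -symV; apply: Xl.
split=> //= x; apply: contrapT => nx.
have {}nx a : A a -> X (x - a) -> False by move=> Aa Xa; apply: nx; exists a.
have XN y : X y -> X (- y) by move=> Xy; rewrite -sub0r; apply: XB.
(* The larger candidate is [X + k x]. If an element of it with [c <> 0] lay in [A], dividing by [c]
   would put [x] in [A + X], against [nx]. *)
apply: (Xmax [set z | exists2 c, X (z - lact c x) & True]).
  split=> [y Xy|/(_ x) Xx].
    by exists 0 => //; rewrite lact0l subr0.
  apply: (nx 0); first exact: sub_set0.
  by rewrite subr0; apply: Xx; exists 1 => //; rewrite lact1 subrr.
split=> [y z [c Xc _] [d Xd _]|c y [d Xd _]|z Az [c Xc _]].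
- exists (c - d) => //; rewrite lactBl.
  suff -> : y - z - (lact c x - lact d x) = (y - lact c x) - (z - lact d x).
    exact: XB.
  by rewrite !opprD !opprK addrACA.
- by exists (c * d) => //; rewrite -lactA -lactB; apply: Xl.
- have [c0|c0] := eqVneq c 0.
    by apply: XA => //; move: Xc; rewrite c0 lact0l subr0.
  have [] := nx (lact c^-1 z); first exact: sub_setl.
  rewrite -[x in X (x - _)](lact1 x) -(mulVf c0) -lactA -lactB.
  by apply: Xl; rewrite -opprB; apply: XN.
Qed.

Lemma field_projection : exists2 p : bimod_hom V V,
  (forall x, A (p x)) & (forall x, A x -> p x = x).
Proof.
have [C [AC0 AC]] := field_complement.
have [|||||p pP pE] := @hom_of_graph _ V V (fun x a => A a /\ C (x - a)).
- by move=> x; have [a Aa Ca] := AC x; exists a.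
- move=> y [Ay]; rewrite sub0r => /(@sub_setN _ _ _ _); rewrite opprK.
  exact: AC0.
- move=> x x' y y' [Ay Cy] [Ay' Cy']; split; first exact: sub_setB.
  suff -> : x - x' - (y - y') = (x - y) - (x' - y') by exact: sub_setB.
  by rewrite !opprD !opprK addrACA.
- by move=> a x y [Ay Cy]; split; [|rewrite -lactB]; apply: sub_setl.
- by move=> a x y [Ay Cy]; split; [|rewrite -ractB]; apply: sub_setr.
exists p => x; first by have [] := pP x.
by move=> Ax; apply: pE; split=> //; rewrite subrr; apply: sub_set0.
Qed.

End Field.

(** * Quotients, sub-bimodules and restriction of scalars *)

Definition quot_hom (S : pzRingType) (M : bimod S) (N : subbimod M) :
  bimod_hom M (quot_bimod N).
Proof.
apply: (@BimodHom _ M (quot_bimod N) (@quot_pi S M N)).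
- exact: quot_piD.
- by move=> a x; rewrite -[RHS]/(quot_lact a (quot_pi N x)) quot_lactE.
- by move=> x a; rewrite -[RHS]/(quot_ract (quot_pi N x) a) quot_ractE.
Defined.

Lemma quot_hom_eq0 (S : pzRingType) (M : bimod S) (N : subbimod M) (x : M) :
  quot_hom N x = 0 <-> N x.
Proof.
by rewrite -(hom0 (quot_hom N)) -[in X in _ <-> X](subr0 x); apply: quot_piP.
Qed.

Lemma quot_hom_surj (S : pzRingType) (M : bimod S) (N : subbimod M) q :
  exists x, quot_hom N x = q.
Proof. by exists (quot_repr q); apply: quot_reprK. Qed.

Definition in_sub (S : pzRingType) (M : bimod S) (N : subbimod M) x (Nx : N x) :
  sub_bimod N := SubSort (introT (mem_subP N x) Nx).

Lemma sub_bimodP (S : pzRingType) (M : bimod S) (N : subbimod M)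
  (x : sub_bimod N) : N (incl N x).
Proof. exact/mem_subP/sub_valP. Qed.

Lemma incl_inj (S : pzRingType) (M : bimod S) (N : subbimod M) :
  injective (incl N).
Proof. exact: val_inj. Qed.

Definition restr_bimod (k S : pzRingType) (eta : {rmorphism k -> S})
  (M : bimod S) : bimod k.
Proof.
apply: (@Bimod k M (fun c => lact (eta c)) (fun x c => ract x (eta c))).
- by move=> c; apply: lactDr.
- by move=> x c d; rewrite rmorphD lactDl.
- by move=> c d x; rewrite rmorphM lactA.
- by move=> x; rewrite rmorph1 lact1.
- by move=> c; apply: ractDl.
- by move=> x c d; rewrite rmorphD ractDr.
- by move=> x c d; rewrite rmorphM ractA.
- by move=> x; rewrite rmorph1 ract1.
- by move=> c x d; rewrite lractA.
Defined.

Definition restr_subbimod (k S : pzRingType) (eta : {rmorphism k -> S})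
  (M : bimod S) (N : subbimod M) : subbimod (restr_bimod eta M).
Proof.
apply: (@Subbimod k (restr_bimod eta M) N).
- exact: (sub_set0 N).
- exact: (@sub_setB _ _ N).
- by move=> c x; apply: (@sub_setl _ _ N).
- by move=> x c; apply: (@sub_setr _ _ N).
Defined.

(** * Additive endomorphisms as bimodules *)

Definition additive_pred (M : zmodType) : {pred M -> M} :=
  fun f => `[< {morph f : x y / x + y} >].

Lemma additive_pred_zmod_closed (M : zmodType) : zmod_closed (@additive_pred M).
Proof.
split=> [|f g /asboolP fD /asboolP gD]; apply/asboolP => x y.
  by rewrite -[RHS]/(0 + 0) addr0.
by rewrite -[LHS]/(f (x + y) - g (x + y)) fD gD opprD addrACA.
Qed.

HB.instance Definition _ (M : zmodType) :=
  GRing.isZmodClosed.Build (M -> M) (@additive_pred M)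
    (@additive_pred_zmod_closed M).

Record add_end (M : zmodType) := AddEnd {
  add_end_fun :> M -> M;
  add_endP : add_end_fun \in @additive_pred M
}.

HB.instance Definition _ (M : zmodType) := [isSub for @add_end_fun M].
HB.instance Definition _ (M : zmodType) := [Choice of add_end M by <:].
HB.instance Definition _ (M : zmodType) :=
  [SubChoice_isSubZmodule of add_end M by <:].

Lemma add_endD (M : zmodType) (f : add_end M) : {morph f : x y / x + y}.
Proof. exact/asboolP/add_endP. Qed.

Lemma add_end_ext (M : zmodType) (f g : add_end M) : f =1 g -> f = g.
Proof. by move=> fg; apply/val_inj/funext. Qed.

Definition to_add_end (M : zmodType) (f : M -> M)
  (fD : {morph f : x y / x + y}) : add_end M :=
  AddEnd (introT (asboolP _) fD : f \in @additive_pred M).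

(** With two scalars one lemma serves both actions: [b = 1] gives the left one and [a = 1] the right
    one. *)
Lemma lend_subproof (S : pzRingType) (M : bimod S) (a b : S) (f : add_end M) :
  {morph (fun x => lact a (f (lact b x))) : x y / x + y}.
Proof. by move=> x y /=; rewrite lactDr add_endD lactDr. Qed.

Lemma rend_subproof (S : pzRingType) (M : bimod S) (a b : S) (f : add_end M) :
  {morph (fun x => ract (f (ract x a)) b) : x y / x + y}.
Proof. by move=> x y /=; rewrite ractDl add_endD ractDl. Qed.

(* [(a f b) x = a f(b x)] on additive endomorphisms: the central elements are
   the left linear maps. *)
Definition lend_bimod (S : pzRingType) (M : bimod S) : bimod S.
Proof.
apply: (@Bimod S (add_end M) (fun a f => to_add_end (lend_subproof a 1 f))
                             (fun f b => to_add_end (lend_subproof 1 b f))).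
- by move=> a f g; apply: add_end_ext => x /=; apply: lactDr.
- by move=> f a b; apply: add_end_ext => x /=; apply: lactDl.
- by move=> a b f; apply: add_end_ext => x /=; rewrite !lact1 lactA.
- by move=> f; apply: add_end_ext => x /=; rewrite !lact1.
- by move=> b f g; apply: add_end_ext => x /=; apply: lactDr.
- move=> f a b; apply: add_end_ext => x /=.
  by rewrite lactDl add_endD lactDr.
- by move=> f a b; apply: add_end_ext => x /=; rewrite !lact1 lactA.
- by move=> f; apply: add_end_ext => x /=; rewrite !lact1.
- by move=> a f b; apply: add_end_ext => x /=; rewrite !lact1.
Defined.

(* [(a f b) x = f(x a) b]: the central elements are the right linear maps. *)
Definition rend_bimod (S : pzRingType) (M : bimod S) : bimod S.
Proof.
apply: (@Bimod S (add_end M) (fun a f => to_add_end (rend_subproof a 1 f))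
                             (fun f b => to_add_end (rend_subproof 1 b f))).
- by move=> a f g; apply: add_end_ext => x /=; apply: ractDl.
- move=> f a b; apply: add_end_ext => x /=.
  by rewrite ractDr add_endD ractDl.
- by move=> a b f; apply: add_end_ext => x /=; rewrite !ract1 ractA.
- by move=> f; apply: add_end_ext => x /=; rewrite !ract1.
- by move=> b f g; apply: add_end_ext => x /=; apply: ractDl.
- by move=> f a b; apply: add_end_ext => x /=; apply: ractDr.
- by move=> f a b; apply: add_end_ext => x /=; rewrite !ract1 ractA.
- by move=> f; apply: add_end_ext => x /=; rewrite !ract1.
- by move=> a f b; apply: add_end_ext => x /=; rewrite !ract1.
Defined.

Lemma lend_commE (S : pzRingType) (M : bimod S) a (f : lend_bimod M) (x : M) :
  (lact a f - ract f a : add_end M) x =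
  lact a ((f : add_end M) x) - (f : add_end M) (lact a x).
Proof.
rewrite -[LHS]/(lact a ((f : add_end M) (lact 1 x))
                - lact 1 ((f : add_end M) (lact a x))).
by rewrite !lact1.
Qed.

Lemma rend_commE (S : pzRingType) (M : bimod S) a (f : rend_bimod M) (x : M) :
  (lact a f - ract f a : add_end M) x =
  (f : add_end M) (ract x a) - ract ((f : add_end M) x) a.
Proof.
rewrite -[LHS]/(ract ((f : add_end M) (ract x a)) 1
                - ract ((f : add_end M) (ract x 1)) a).
by rewrite !ract1.
Qed.

(* Additive endomorphisms that kill [A] and map into [A]: the difference of
   two projections onto [A] is of this kind. *)
Definition proj_defect (M : zmodType) (A : M -> Prop) (f : add_end M) :=
  (forall x, A (f x)) /\ (forall x, A x -> f x = 0).

Definition lend_defect (S : pzRingType) (M : bimod S) (A : subbimod M) :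
  subbimod (lend_bimod M).
Proof.
apply: (@Subbimod S (lend_bimod M) (proj_defect A)).
- by split=> // x; apply: sub_set0.
- move=> f g [fA f0] [gA g0]; split=> x; first exact: (sub_setB (fA x) (gA x)).
  by move=> Ax; rewrite -[LHS]/(f x - g x) f0 // g0 // subrr.
- move=> a f [fA f0]; split=> x /=; first exact: sub_setl.
  by move=> Ax; rewrite lact1 f0 // lact0.
- move=> f a [fA f0]; split=> x /=; first exact: sub_setl.
  by move=> Ax; rewrite f0 ?lact0 //; apply: sub_setl.
Defined.

(** Left linearity is built in, so that a correction by such a map keeps the left linearity already
    achieved. *)
Definition rend_defect (S : pzRingType) (M : bimod S) (A : subbimod M) :
  subbimod (rend_bimod M).
Proof.
apply: (@Subbimod S (rend_bimod M) [set f | proj_defect A f /\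
          forall a x, f (lact a x) = lact a (f x)]) => /=.
- split; last by move=> a x; rewrite -[RHS]/(lact a 0) lact0.
  by split=> // x; apply: sub_set0.
- move=> f g [[fA f0] fl] [[gA g0] gl]; split; first split=> x.
  + exact: (sub_setB (fA x) (gA x)).
  + by move=> Ax; rewrite -[LHS]/(f x - g x) f0 // g0 // subrr.
  + move=> a x; rewrite -[LHS]/(f (lact a x) - g (lact a x)) fl gl.
    by rewrite -[RHS]/(lact a (f x - g x)) lactB.
- move=> a f [[fA f0] fl]; split; first split=> x /=.
  + by rewrite ract1.
  + by move=> Ax; rewrite ract1 f0 //; apply: sub_setr.
  + by move=> b x /=; rewrite !ract1 lractA fl.
- move=> f a [[fA f0] fl]; split; first split=> x /=.
  + exact: sub_setr.
  + by move=> Ax; rewrite ract1 f0 // ract0.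
  + by move=> b x /=; rewrite !ract1 fl lractA.
Defined.

(** The complement is the kernel of [p] inside [B]. *)
Lemma direct_summand_of_projection (S : pzRingType) (M : bimod S)
  (A B : subbimod M) (p : bimod_hom M M) :
  sub_set A `<=` sub_set B -> (forall x, A (p x)) ->
  (forall x, A x -> p x = x) -> direct_summand A B.
Proof.
move=> AB pA pE; split=> //.
unshelve eexists (@Subbimod _ M [set x | B x /\ p x = 0] _ _ _ _).
- by split; [exact: sub_set0 | exact: hom0].
- move=> x y [Bx px] [By py]; split; first exact: sub_setB.
  by rewrite homB px py subrr.
- by move=> a x [Bx px]; split; [exact: sub_setl | rewrite homl px lact0].
- by move=> x a [Bx px]; split; [exact: sub_setr | rewrite homr px ract0].
split; apply/seteqP; split=> [x|x].
- by move=> [/pE xE [_ px]]; rewrite /= -xE.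
- by move=> ->; do !split; rewrite ?hom0 //; apply: sub_set0.
- move=> Bx; exists (p x) => //; exists (x - p x); last by rewrite addrC subrK.
  split; last by rewrite homB (pE (p x)) ?subrr.
  by apply: sub_setB => //; apply: AB.
- by move=> [a Aa [c [Bc _] <-]]; apply: sub_setD => //; apply: AB.
Qed.

(** * Projections over a separable algebra *)

Section Separable.
Variables (k : fieldType) (S : pzRingType) (eta : {rmorphism k -> S}).
Hypotheses (eta_central : central eta) (sepS : separable eta).

(** The largest symmetric sub-bimodule. Separability tests symmetric bimodules only, and
    [lend_bimod] and [rend_bimod] need not be symmetric. *)
Definition sym_part (M : bimod S) : subbimod M.
Proof.
apply: (@Subbimod S M [set x | forall c, lact (eta c) x = ract x (eta c)]).
- by move=> c; rewrite lact0 ract0.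
- by move=> x y xc yc c; rewrite lactB ractB xc yc.
- by move=> a x xc c; rewrite lactA eta_central -lactA xc lractA.
- by move=> x a xc c; rewrite -lractA xc !ractA eta_central.
Defined.

Lemma symmetric_sub (M : bimod S) (N : subbimod M) :
  sub_set N `<=` sub_set (sym_part M) -> symmetric_over eta (sub_bimod N).
Proof.
by move=> Nsym c x; apply: incl_inj; rewrite homl homr; apply/Nsym/sub_bimodP.
Qed.

Lemma symmetric_quot (M : bimod S) (N : subbimod M) :
  symmetric_over eta M -> symmetric_over eta (quot_bimod N).
Proof.
by move=> symM c q; have [x <-] := quot_hom_surj q; rewrite -homl -homr symM.
Qed.

(** The class of [x] modulo [K] is central, so multiplying it by [a] defines a bimodule map from [S]
    to the quotient. A lift of this map sends [1] to the required [y], which is central because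
    [a 1 = 1 a] in [S]. *)
Lemma central_lift (M : bimod S) (K : subbimod M) x :
  (forall c, lact (eta c) x = ract x (eta c)) ->
  (forall a, K (lact a x - ract x a)) ->
  exists2 y, K (x - y) & forall a, lact a y = ract y a.
Proof.
move=> xsym xK; pose N := sym_part M.
pose x' : sub_bimod N := @in_sub _ _ N x xsym.
pose q := quot_hom (preim_subbimod (incl N) K).
have qc a : lact a (q x') = ract (q x') a.
  rewrite -homl -homr; apply/eqP; rewrite -subr_eq0 -homB.
  by apply/eqP/quot_hom_eq0; apply: xK.
unshelve epose (f := @BimodHom S (regular_bimod S) _
  (fun a => lact a (q x')) _ _ _).
- by move=> a b; rewrite lactDl.
- by move=> a b; rewrite lactA.
- by move=> a b; rewrite lractA -qc lactA.
have symN : symmetric_over eta (sub_bimod N) by apply: symmetric_sub.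
have [h hq] := sepS.2 _ _ q f symN (symmetric_quot symN) (@quot_hom_surj _ _ _).
exists (incl N (h 1)).
  have /quot_hom_eq0 : q (x' - h 1) = 0.
    by rewrite homB hq -[f 1]/(lact 1 (q x')) lact1 subrr.
  by rewrite -[sub_set _ _]/(K (incl N (x' - h 1))) homB.
by move=> a; rewrite -homl -homr -homl -homr /= mul1r mulr1.
Qed.

Lemma separable_projection (M : bimod S) (A : subbimod M) :
  symmetric_over eta M ->
  exists2 p : bimod_hom M M, (forall x, A (p x)) & (forall x, A x -> p x = x).
Proof.
move=> symM; have [p pA pE] :=
  @field_projection k (restr_bimod eta M) (restr_subbimod eta A) symM.
pose p0 : add_end M := to_add_end (homD p).
have p0A x : A (p0 x) by apply: pA.
have p0E x : A x -> p0 x = x by apply: pE.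
have p0l c x : p0 (lact (eta c) x) = lact (eta c) (p0 x) by apply: (homl p).
move: p0 p0A p0E p0l => {pA pE}p pA pE pl.
(* The commutators of [p] are defects because [p] maps into [A] and is the identity on [A]. Changing
   [p] by a defect preserves these two properties. *)
have [||p1 [p1A p1E] p1l] := @central_lift (lend_bimod M) (lend_defect A) p.
- by move=> c; apply: add_end_ext => x /=; rewrite !lact1 pl.
- move=> a; split=> x; rewrite lend_commE.
    by apply: sub_setB; [apply: sub_setl|]; apply: pA.
  by move=> Ax; rewrite !pE ?subrr //; apply: sub_setl.
have {}p1l a x : p1 (lact a x) = lact a (p1 x).
  by have /(congr1 (fun f : add_end M => f x)) := p1l a; rewrite /= !lact1.
have {}p1A x : A (p1 x).
  rewrite -[p1 x](subKr (p x)); apply: sub_setB; first exact: pA.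
  exact: p1A.
have {}p1E x : A x -> p1 x = x.
  move=> Ax; apply/esym/eqP; rewrite -subr_eq0 -[X in X - _]pE //.
  by apply/eqP; apply: p1E.
(* The same correction on the right; the commutators of [p1] are left linear since [p1] is. *)
have [||p2 [[p2A p2E] p2l] p2r] :=
  @central_lift (rend_bimod M) (rend_defect A) p1.
(* Symmetry of [M] turns right scalars from [k] into left ones, with which [p1] commutes. *)
- by move=> c; apply: add_end_ext => x /=; rewrite !ract1 -!symM p1l.
- move=> a; split; first split=> x; rewrite ?rend_commE.
  + by apply: sub_setB; [|apply: sub_setr]; apply: p1A.
  + by move=> Ax; rewrite !p1E ?subrr //; apply: sub_setr.
  + by move=> b x; rewrite !rend_commE lractA !p1l lactB lractA.
have {}p2r x a : p2 (ract x a) = ract (p2 x) a.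
  by have /(congr1 (fun f : add_end M => f x)) := p2r a; rewrite /= !ract1.
have {}p2l a x : p2 (lact a x) = lact a (p2 x).
  (* Subtracting both sides from [p1 (lact a x)] reduces the claim to left linearity of [p1] and of
     [p1 - p2]. *)
  apply/eqP; rewrite -(inj_eq (inv_inj (@subKr _ (p1 (lact a x))))).
  rewrite {2}p1l -lactB; apply/eqP; exact: p2l.
exists (BimodHom (add_endD p2) p2l p2r) => x /=.
  rewrite -[p2 x](subKr (p1 x)); apply: sub_setB; first exact: p1A.
  exact: p2A.
move=> Ax; apply/esym/eqP; rewrite -subr_eq0 -[X in X - _]p1E //.
by apply/eqP; apply: p2E.
Qed.

End Separable.

(** * Leading components *)

Section Leading.
Variables (S T : pzRingType) (iota : {rmorphism S -> T}) (G : grading iota).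
Variable P : subbimod (sring_bimod iota).
Notation Tm := (sring_bimod iota).
Notation p := (hproj G).

Lemma hproj_eq0 (n : nat) (t : Tm) : sum_lt (hcomp G) n t -> p n t = 0.
Proof.
move=> [u [Gu ->]]; rewrite hom_sum big1 // => i _.
by apply: hproj_neq (Gu i) => ni; have := ltn_ord i; rewrite ni ltnn.
Qed.

(** With [hproj_eq0], this identifies the kernel of [p n] on [upto G n], so equal leading components
    mean a difference of lower degree. *)
Lemma sum_lt_hproj (n : nat) (t : Tm) :
  upto G n t -> p n t = 0 -> sum_lt (hcomp G) n t.
Proof.
move=> [u [Gu ->]]; rewrite big_ord_recr /= homD (hproj_id (Gu n)) hproj_eq0.
  by rewrite add0r => ->; exists u; rewrite addr0.
by exists u.
Qed.

Lemma hproj_hproj (m n : nat) (t : Tm) :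
  p m (p n t) = if m == n then p n t else 0.
Proof.
case: eqP => [->|mn]; first by rewrite hproj_id //; apply: hproj_comp.
by apply: hproj_neq (hproj_comp G n t) => nm; apply: mn.
Qed.

(** * The filtered morphism defined by complements *)

Section Complements.
Variable C : nat -> subbimod Tm.
Hypothesis C_sub : forall n x, C n x -> capupto G P n x.
Hypothesis C_inj : forall n x, C n x -> p n x = 0 -> x = 0.
Hypothesis C_surj : forall n x, capupto G P n x ->
  exists2 c, C n c & p n c = p n x.

(* [t = c_0 + c_1 + ...] with [c_n] the lift to [C n] of the component of
   degree [n] of [r]. *)
Let lifts (r : sub_bimod (lead G P)) (t : Tm) := exists u : nat -> Tm,
  [/\ forall n, C n (u n), forall n, p n (u n) = p n (incl _ r) &
      exists N, forall m, (N <= m)%N -> t = \sum_(n < m) u n].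

Let lifts_total r : exists t, lifts r t.
Proof.
have [N _ [v [vR rE]]] := sub_bimodP r.
have vE m : exists c, C m c /\ p m c = v m.
  have [x Px <-] := vR m; have [c Cc cx] := C_surj Px.
  by exists c.
(* Only the first [N] terms of [v] add up to [r]; the later ones are arbitrary, so their lifts are
   replaced by [0]. *)
have [c cP] := choice vE; pose u n := if (n < N)%N then c n else 0.
exists (\sum_(n < N) u n); exists u; split=> [n|n|].
- by rewrite /u; case: ifP => _; [have [] := cP n | exact: sub_set0].
- rewrite rE hom_sum.
  under eq_bigr => i _ do rewrite -(cP i).2 hproj_hproj.
  rewrite -big_mkcond /= /u; case: ltnP => nN.
    by rewrite (big_pred1 (Ordinal nN)).
  rewrite hom0 big1 // => i /eqP ni.
  by move: (ltn_ord i); rewrite -ni ltnNge nN.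
- exists N => m Nm; rewrite (big_ord_widen m u Nm) big_mkcond /=.
  by apply: eq_bigr => i _; rewrite /u; case: ltnP.
Qed.

Let lifts_hom : exists2 alpha : bimod_hom (sub_bimod (lead G P)) Tm,
  forall r, lifts r (alpha r) & forall r t, lifts r t -> alpha r = t.
Proof.
apply: hom_of_graph => [|t|r r' t t'|a r t|a r t].
- exact: lifts_total.
- move=> [u [Cu uE [N tE]]]; rewrite (tE N) // big1 // => i _.
  by apply: C_inj (Cu i) _; rewrite uE !hom0.
- move=> [u [Cu uE [N tE]]] [u' [Cu' uE' [N' tE']]].
  exists (fun n => u n - u' n); split=> [n|n|].
  + exact: sub_setB.
  + by rewrite !homB uE uE'.
  (* Since all sufficiently long partial sums equal [t], both sums can be taken to a common
     length. *)
  + exists (maxn N N') => m; rewrite geq_max => /andP[Nm Nm'].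
    by rewrite (tE m) // (tE' m) // sumrB.
- move=> [u [Cu uE [N tE]]]; exists (fun n => lact a (u n)); split=> [n|n|].
  + exact: sub_setl.
  + by rewrite !homl uE.
  + exists N => m Nm.
    by rewrite (tE m) // (big_morph _ (lactDr a) (lact0 Tm a)).
- move=> [u [Cu uE [N tE]]]; exists (fun n => ract (u n) a); split=> [n|n|].
  + exact: sub_setr.
  + by rewrite !homr uE.
  + exists N => m Nm.
    by rewrite (tE m) // (big_morph _ (ractDl a) (ract0 Tm a)).
Qed.

Lemma filtered_of_complements :
  exists alpha : bimod_hom (sub_bimod (lead G P)) Tm,
    filtered_morphism G alpha /\ sub_set P = range alpha.
Proof.
have [alpha alphaP alphaE] := lifts_hom; exists alpha.
(* For [r] homogeneous of degree [n], all lifts but the [n]-th vanish by [C_inj], so [alpha r] is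
   that single lift. *)
have alpha_homog n r : hcomp G n (incl _ r) ->
    C n (alpha r) /\ p n (alpha r) = incl _ r.
  move=> Gr; have [u [Cu uE [N tE]]] := alphaP r.
  have u0 m : m <> n -> u m = 0.
    move=> mn; apply: C_inj (Cu m) _; rewrite uE.
    by apply: hproj_neq Gr => nm; apply: mn.
  (* A length at which the sum is stable and includes the index [n]. *)
  have nm : (n < maxn N n.+1)%N by rewrite leq_max ltnSn orbT.
  rewrite (tE (maxn N n.+1)) ?leq_maxl // (bigD1 (Ordinal nm)) //= big1.
    by rewrite addr0 uE hproj_id.
  by move=> i /eqP ni; apply: u0 => /= i_n; apply: ni; apply: val_inj.
split; first split.
- by move=> n r /alpha_homog[/C_sub[]].
- by move=> n r /[dup] Gr /alpha_homog[_]; rewrite subn0.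
apply/seteqP; split=> [x Px|_ [r _ <-]]; last first.
  have [u [Cu _ [N tE]]] := alphaP r; rewrite (tE N) //.
  by apply: sub_set_sum => m; have [] := C_sub (Cu m).
(* The preimage of [c] is its leading component, whose only nonzero lift is [c] itself. *)
have alpha_C n c : C n c -> exists r, alpha r = c.
  move=> Cc; have Rc : lead G P (p n c).
    exists n.+1 => //; exists (fun m => if m == n then p n c else 0).
    split=> [m|]; last by rewrite big_ord_recr /= eqxx big1 ?add0r // => i _;
      rewrite ltn_eqF.
    case: eqP => [->|_]; last exact: sub_set0.
    by exists c => //; apply: C_sub.
  exists (in_sub Rc); apply: alphaE; exists (fun m => if m == n then c else 0).
  split=> [m|m|].
  - by case: eqP => [->|_] //; exact: sub_set0.
  - by rewrite hproj_hproj; case: eqP => [->|_] //; rewrite hom0.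
  - exists n.+1 => m nm; rewrite -big_mkcond /=.
    by rewrite (big_pred1 (Ordinal nm)).
have [N xE] := hproj_sum G x.
have : sum_lt (hcomp G) N x.
  by exists (fun n => p n x); split=> // m; apply: hproj_comp.
(* [N] is a strict bound on the degree, so [N = 0] forces [x = 0]. Otherwise subtracting [c] in
   [C n] with the same component of degree [n] lowers the bound. *)
elim: N x Px {xE} => [|n IHn] x Px xN.
  by exists 0 => //; have [u [_ ->]] := xN; rewrite hom0 big_ord0.
have [c Cc cx] := C_surj (conj Px xN : capupto G P n x).
have [r' r'E] := alpha_C _ _ Cc; have [Pc cn] := C_sub Cc.
have [||r _ rE] := IHn (x - c); first exact: sub_setB.
  by apply: sum_lt_hproj; [exact: sub_setB | rewrite homB cx subrr].
by exists (r + r') => //; rewrite homD rE r'E subrK.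
Qed.

End Complements.

(** * Complements from direct summands and from projectivity *)

Lemma filtered_of_summands :
  (forall n, direct_summand (caplt G P n) (capupto G P n)) ->
  exists alpha : bimod_hom (sub_bimod (lead G P)) Tm,
    filtered_morphism G alpha /\ sub_set P = range alpha.
Proof.
move=> /(fun H n => (H n).2)/choice[C CP].
have CS n x : C n x -> capupto G P n x.
  move=> Cx; have [_ E] := CP n; rewrite -[capupto _ _ _ _]/(sub_set _ x) E.
  by exists 0; [exact: sub_set0 | exists x => //; rewrite add0r].
apply: (@filtered_of_complements C) => // n x.
- move=> Cx x0; have [E _] := CP n; suff: [set 0] x by [].
  rewrite -E; split=> //; have [Px xn] := CS _ _ Cx.
  by split=> //; apply: sum_lt_hproj.
- move=> Px; have [_ E] := CP n; move: Px.
  rewrite -[capupto _ _ _ _]/(sub_set _ x) E => -[a [_ an] [c Cc <-]].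
  by exists c => //; rewrite homD (hproj_eq0 an) add0r.
Qed.

(** [caplt G P n.+1] is [capupto G P n] by conversion. Only degree [0] remains, where [caplt] is
    zero and the complement is everything. *)
Lemma filtered_of_upto_summands :
  (forall n, direct_summand (capupto G P n) (capupto G P n.+1)) ->
  exists alpha : bimod_hom (sub_bimod (lead G P)) Tm,
    filtered_morphism G alpha /\ sub_set P = range alpha.
Proof.
move=> H; apply: filtered_of_summands => -[|n]; last exact: H.
have lt0 x : caplt G P 0 x -> x = 0 by case=> _ [u [_ ->]]; rewrite big_ord0.
split=> [x /lt0->|]; first exact: sub_set0.
exists (capupto G P 0); split; apply/seteqP; split=> [x|x].
- by case=> /lt0.
- by move=> ->; split; apply: sub_set0.
- by move=> Px; exists 0; [exact: sub_set0 | exists x => //; rewrite add0r].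
- by move=> [a /lt0-> [c Pc <-]]; rewrite add0r.
Qed.

(** The complement is the image of [s]: [x] minus the section of its class has class zero, hence
    lies in [caplt G P n]. *)
Lemma summand_of_section (n : nat)
  (s : bimod_hom (subquot_bimod (capupto G P n) (caplt G P n))
                 (sub_bimod (capupto G P n))) :
  cancel s (quot_hom _) -> direct_summand (caplt G P n) (capupto G P n).
Proof.
move=> sK; have le x : caplt G P n x -> capupto G P n x.
  by move=> [Px xn]; split=> //; apply: sum_lt_le xn.
split; first exact: le.
unshelve eexists (@Subbimod _ Tm [set x | exists q, incl _ (s q) = x] _ _ _ _).
- by exists 0; rewrite !hom0.
- by move=> _ _ [q <-] [r <-]; exists (q - r); rewrite !homB.
- by move=> a _ [q <-]; exists (lact a q); rewrite !homl.
- by move=> _ a [q <-]; exists (ract q a); rewrite !homr.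
split; apply/seteqP; split=> [x|x].
- move=> [xn [q xE]]; suff q0 : q = 0 by rewrite -xE q0 !hom0.
  move: xn; rewrite -xE -[in X in _ -> X](sK q) => xn.
  have [_] := quot_hom_eq0 (preim_subbimod (incl _) (caplt G P n)) (s q).
  by apply.
- move=> ->; split; first exact: sub_set0.
  by exists 0; rewrite !hom0.
- move=> Px; pose x' := in_sub Px.
  pose q := quot_hom (preim_subbimod (incl (capupto G P n)) (caplt G P n)) x'.
  exists (x - incl _ (s q)); last first.
    by exists (incl _ (s q)); [exists q | rewrite subrK].
  have /quot_hom_eq0 : quot_hom (preim_subbimod (incl (capupto G P n))
    (caplt G P n)) (x' - s q) = 0 by rewrite homB sK subrr.
  by rewrite -[sub_set _ _]/(caplt G P n (incl _ (x' - s q))) homB.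
- move=> [a an [_ [q <-] <-]]; apply: sub_setD; first exact: le.
  exact: sub_bimodP.
Qed.

(** The class [K] lets one argument cover both all bimodules and those symmetric over a field.
    Lifting the projection [pr] and composing with the inclusion [i] of the [n]-th summand gives the
    section. *)
Lemma filtered_of_projective (K : bimod S -> Prop) :
  projective_in K (gr G P) -> (forall n, K (sub_bimod (capupto G P n))) ->
  (forall n, K (subquot_bimod (capupto G P n) (caplt G P n))) ->
  exists alpha : bimod_hom (sub_bimod (lead G P)) Tm,
    filtered_morphism G alpha /\ sub_set P = range alpha.
Proof.
move=> [_ projP] Ksub Kquot; apply: filtered_of_summands => n.
pose Q m := subquot_bimod (capupto G P m) (caplt G P m).
unshelve epose (pr := @BimodHom _ (gr G P) (Q n)
  (fun f => sub_val f n) _ _ _) => //.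
have [h hP] :=
  projP _ _ (quot_hom _) pr (Ksub n) (Kquot n) (@quot_hom_surj _ _ _).
(* The inclusion of the [n]-th summand, given by its graph so that linearity is checked
   componentwise. *)
have [|||||i iP _] := @hom_of_graph _ (Q n) (gr G P)
    (fun q f => sub_val f n = q /\ forall m, m != n -> sub_val f m = 0).
- move=> q; pose f : prod_bimod Q := dfwith (fun m => 0 : Q m) q.
  have ff : finsupp_subbimod Q f.
    by exists n.+1 => m nm; apply: dfwith_out; rewrite ltn_eqF.
  exists (in_sub ff); split=> [|m mn] /=; first exact: dfwith_in.
  by apply: dfwith_out; rewrite eq_sym.
- move=> f [fn f0]; apply: incl_inj; apply: functional_extensionality_dep => m.
  by have [->|/f0] := eqVneq m n.
- move=> q q' f f' [fn f0] [f'n f'0]; split=> [|m mn].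
    by rewrite -fn -f'n.
  by rewrite -[LHS]/(sub_val f m - sub_val f' m) f0 // f'0 // subrr.
- move=> a q f [fn f0]; split=> [|m mn]; first by rewrite -fn.
  by rewrite -[LHS]/(lact a (sub_val f m)) f0 //; exact: lact0.
- move=> a q f [fn f0]; split=> [|m mn]; first by rewrite -fn.
  by rewrite -[LHS]/(ract (sub_val f m) a) f0 //; exact: ract0.
unshelve epose (s := @BimodHom _ (Q n) (sub_bimod (capupto G P n))
  (h \o i) _ _ _).
- by move=> x y /=; rewrite !homD.
- by move=> a x /=; rewrite !homl.
- by move=> x a /=; rewrite !homr.
by apply: (@summand_of_section n s) => q; rewrite hP; have [] := iP q.
Qed.

End Leading.

Theorem theorem2p4 :
  (forall (S T : pzRingType) (iota : {rmorphism S -> T}) (G : grading iota)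
      (P : subbimod (sring_bimod iota)),
    connected G ->
    ((forall n : nat, direct_summand (capupto G P n) (capupto G P n.+1)) ->
     exists alpha : bimod_hom (sub_bimod (lead G P)) (sring_bimod iota),
       filtered_morphism G alpha /\ sub_set P = range alpha)
    /\
    (projective (gr G P) ->
     exists alpha : bimod_hom (sub_bimod (lead G P)) (sring_bimod iota),
       filtered_morphism G alpha /\ sub_set P = range alpha))
  /\
  (forall (k : fieldType) (S : pzRingType) (eta : {rmorphism k -> S})
      (T : pzRingType) (iota : {rmorphism S -> T}) (G : grading iota),
    central eta ->
    symmetric_over eta (sring_bimod iota) ->
    connected G ->
    (forall P : subbimod (sring_bimod iota),
      projective_over eta (gr G P) ->
      exists alpha : bimod_hom (sub_bimod (lead G P)) (sring_bimod iota),
        filtered_morphism G alpha /\ sub_set P = range alpha)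
    /\
    (separable eta ->
     forall P : subbimod (sring_bimod iota),
      exists alpha : bimod_hom (sub_bimod (lead G P)) (sring_bimod iota),
        filtered_morphism G alpha /\ sub_set P = range alpha)).
Proof.
split=> [S T iota G P _|k S eta T iota G eta_c symT _].
  split; first exact: filtered_of_upto_summands.
  by move=> projP; apply: filtered_of_projective projP _ _.
have symsub (N : subbimod (sring_bimod iota)) :
    symmetric_over eta (sub_bimod N).
  by move=> c x; apply: incl_inj; rewrite homl homr symT.
split=> [P projP|sepS P].
  by apply: filtered_of_projective projP _ _ => n //; apply: symmetric_quot.
(* Projectivity of [gr G P] is bypassed: over a separable algebra each [caplt G P n] is already the
   image of a projection of [T]. *)
apply: filtered_of_summands => n.
have [p pA pE] := separable_projection eta_c sepS (caplt G P n) symT.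
apply: direct_summand_of_projection pA pE => x [Px xn].
by split=> //; apply: sum_lt_le xn.
Qed.
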